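(* Let $h\in\omega^\omega$ with $\limsup_n h(n)=\infty$. Then $f\mathcal{N}(h)\perp\mathcal{M}$, i.e. there are $A\in f\mathcal{N}(h)$ and $B\in\mathcal{M}$ with $A\cup B=\omega^\omega$.
   Context: $\mathcal{M}$ is the $\sigma$-ideal of meager subsets of the Baire space $\omega^\omega$. For $\sigma\in\omega^{<\omega}$, $[\sigma]=\{x\in\omega^\omega:\sigma\subseteq x\}$ and $|\sigma|$ is the length of $\sigma$. For $h\in\omega^\omega$ with $\limsup_n h(n)=\infty$, a set $F\subseteq\omega^\omega$ belongs to $f\mathcal{N}(h)$ if for every $\varepsilon>0$ there is a sequence $(\sigma_n)_{n\in\omega}$ in $\omega^{<\omega}$ with $\sum_{n\in\omega}\frac{1}{h(|\sigma_n|)}<\varepsilon$ and $F\subseteq\bigcup_{n\in\omega}[\sigma_n]$. Convention: $1/0=\infty$. Families $\mathcal{I},\mathcal{J}$ of subsets of $\omega^\omega$ are orthogonal, $\mathcal{I}\perp\mathcal{J}$, if there are $A\in\mathcal{I}$, $B\in\mathcal{J}$ with $A\cup B=\omega^\omega$. *)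

(* Defs.v *)
From HB Require Import structures.
From mathcomp Require Import all_boot all_order all_algebra.
From mathcomp Require Import all_classical all_reals all_analysis.

Set Implicit Arguments.
Unset Strict Implicit.
Unset Printing Implicit Defensive.

Import Order.TTheory GRing.Theory Num.Theory.
Import numFieldNormedType.Exports.

Local Open Scope classical_set_scope.
Local Open Scope ring_scope.
Local Open Scope ereal_scope.

(* The topology on [nat] provided by the library is the discrete one. *)
Definition baire_space : Type := prod_topology (fun _ : nat => nat).

HB.instance Definition _ := Pointed.on baire_space.
HB.instance Definition _ := Nbhs.on baire_space.
HB.instance Definition _ := Topological.on baire_space.
HB.instance Definition _ := Uniform.on baire_space.

Definition nowhere_dense (T : topologicalType) (A : set T) : Prop :=
  interior (closure A) = set0.

Definition meager (T : topologicalType) : set (set T) :=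
  [set A | exists F : nat -> set T,
     (forall n, nowhere_dense (F n)) /\ A = \bigcup_n F n].

Definition cylinder (s : seq nat) : set baire_space :=
  [set x | forall i, (i < size s)%N -> x i = nth 0%N s i].

(* The inverse is taken in [\bar R], where [0^-1 = +oo]; a sequence with
   [h (size (s n)) = 0] for some [n] therefore has an infinite sum. *)
Definition fN (R : realType) (h : nat -> nat) : set (set baire_space) :=
  [set F | forall e : R, (0 < e)%R ->
     exists s : nat -> seq nat,
       \sum_(0 <= n <oo) ((h (size (s n)))%:R%:E : \bar R)^-1 < e%:E /\
       F `<=` \bigcup_n cylinder (s n)].

Definition orthogonal_families (T : Type) (I J : set (set T)) : Prop :=
  exists A B : set T, [/\ I A, J B & A `|` B = setT].

(* Main.v *)
Require Import Defs.
From mathcomp Require Import all_boot all_order all_algebra.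
From mathcomp Require Import all_classical all_reals all_analysis.

(** The finite sequences are countable, and so are the points of the Baire
    space that are eventually zero; these points are dense.  Since [h] takes
    arbitrarily large values at arbitrarily large arguments, any finite
    sequence can be padded with zeros to a length at which [h] is as large as
    desired, and the cylinder of the padded sequence still contains the
    eventually zero point with the original prefix.  Doing this for the [k]-th
    finite sequence with weight at most [e / 2 ^ k.+1] covers all eventually
    zero points by cylinders of total weight at most [e]
    ([small_cover_eventually_zero]).  The union [U e] of these cylinders is
    open and dense, so its complement is nowhere dense
    ([nowhere_dense_setC_eventually_zero]).  Letting [e] run through the
    numbers [1 / m.+1], the intersection of the sets [U e] is in [fN R h] and
    its complement is a countable union of nowhere dense sets. *)

Set Implicit Arguments.
Unset Strict Implicit.
Unset Printing Implicit Defensive.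

Import Order.TTheory GRing.Theory Num.Theory.

Local Open Scope classical_set_scope.

Lemma open_cylinder (s : seq nat) : open (cylinder s).
Proof.
have -> : cylinder s =
    \bigcap_(i in `I_(size s)) (proj i @^-1` [set nth 0%N s i]).
  by rewrite eqEsubset; split=> x sx i /=; apply: sx.
rewrite bigcap_mkord; apply: big_ind => [|A B oA oB|i _]; [exact: openT|exact: openI|].
apply: open_comp; last exact: discrete_open.
by move=> x _; exact: proj_continuous.
Qed.

(** Zeros beyond [s] come from the default value of [nth], so these points are
    exactly the eventually zero ones. *)
Definition zero_extension (s : seq nat) : baire_space := nth 0%N s.

(** Each coordinate of the truncations of [x] is eventually constant, and the
    topology is that of pointwise convergence; hence the eventually zero points
    are dense. *)
Lemma cvg_zero_extension (x : baire_space) :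
  zero_extension (mkseq x n) @[n --> \oo] --> x.
Proof.
apply/cvg_sup => N U [V] [[W] oW <-] WxN WU.
apply: (filterS WU); rewrite nbhs_simpl /=; exists N.+1 => // n /= Nn.
by rewrite /zero_extension nth_mkseq.
Qed.

(** A neighbourhood of any point meets the dense set of eventually zero points,
    so it is never inside the closed set [~` U]. *)
Lemma nowhere_dense_setC_eventually_zero (U : set baire_space) :
  open U -> (forall s, U (zero_extension s)) -> nowhere_dense (~` U).
Proof.
move=> oU Uz; rewrite /nowhere_dense.
rewrite -(closure_id _).1; last by rewrite closedC.
rewrite -subset0 => x /cvg_zero_extension.
rewrite nbhs_simpl => -[N _ /(_ N (leqnn N))] /=; apply; exact: Uz.
Qed.

(** The limsup is the infimum over tails of the supremum on the tail; a bound
    [M] for [h] on one tail would bound the limsup. *)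
Lemma limn_esup_pinfty_unbounded (R : realType) (h : nat -> nat) :
  limn_esup (fun n : nat => ((h n)%:R%:E : \bar R)) = (+oo)%E ->
  forall N M, exists2 L, (N <= L)%N & (M <= h L)%N.
Proof.
move=> hsup N M; apply: contrapT => noL.
have : (limn_esup (fun n : nat => ((h n)%:R%:E : \bar R)) <= M%:R%:E)%E.
  apply: ge_ereal_inf.
  exists (ereal_sup ((fun n => (h n)%:R%:E) @` [set n | (N <= n)%N])).
    by exists [set n | (N <= n)%N] => //; exists N.
  apply: ge_ereal_sup => _ [n /= Nn <-]; rewrite lee_fin ler_nat leqNgt.
  by apply/negP => /ltnW Mh; apply: noL; exists n.
by rewrite hsup.
Qed.

Definition pad (s : seq nat) (n : nat) := s ++ nseq (n - size s) 0%N.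

Lemma cylinder_pad_zero_extension s n :
  cylinder (pad s n) (zero_extension s).
Proof.
move=> i _; rewrite /zero_extension /pad nth_cat nth_nseq if_same.
by case: ltnP => // si; rewrite nth_default.
Qed.

(** Only the length of a sequence counts in the sum, so padding with zeros makes
    the weight of each cylinder as small as desired without losing the
    eventually zero point that it is meant to cover. *)
Lemma small_cover_eventually_zero (R : realType) (h : nat -> nat) (e : R) :
  (forall N M, exists2 L, (N <= L)%N & (M <= h L)%N) -> (0 < e)%R ->
  exists t : nat -> seq nat,
    (\sum_(0 <= k <oo) (((h (size (t k)))%:R%:E : \bar R)^-1) <= e%:E)%E /\
    forall s, (\bigcup_k cylinder (t k)) (zero_extension s).
Proof.
move=> hub e0.
pose q k : seq nat := odflt [::] (unpickle k).
(* This bound on [h] makes the [k]-th weight at most [e / 2 ^ k.+1]. *)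
have /choice[L hL] : forall k, exists L, (size (q k) <= L)%N /\
    ((2 ^ k.+1)%:R / e <= (h L)%:R :> R)%R.
  move=> k; set r := ((2 ^ k.+1)%:R / e)%R.
  have [L qL hL] := hub (size (q k)) (Num.bound r).
  exists L; split => //; apply: (@le_trans _ _ (Num.bound r)%:R)%R.
    by apply/ltW/archi_boundP; rewrite divr_ge0// ltW.
  by rewrite ler_nat.
exists (fun k => pad (q k) (L k)); split; last first.
  move=> s; exists (pickle s) => //.
  by rewrite /q pickleK; exact: cylinder_pad_zero_extension.
apply: le_trans (epsilon_trick0 xpredT (ltW e0)).
apply: lee_nneseries => [k _ _|k _]; first by rewrite inve_ge0 lee_fin.
have [qL ehL] := hL k.
have p0 : (0 < (2 ^ k.+1)%:R / e :> R)%R.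
  by rewrite divr_gt0// ltr0n expn_gt0.
rewrite /pad size_cat size_nseq subnKC// inver gt_eqF; last exact: lt_le_trans ehL.
rewrite lee_fin -[leRHS]invrK invf_div lef_pV2 // posrE //.
exact: lt_le_trans ehL.
Qed.

Theorem proposition10 (R : realType) (h : nat -> nat)
    (hsup : limn_esup (fun n : nat => ((h n)%:R%:E : \bar R)) = (+oo)%E) :
  orthogonal_families (fN R h) (@meager baire_space).
Proof.
have hub := limn_esup_pinfty_unbounded hsup.
have /choice[t ht] : forall m, exists t : nat -> seq nat,
    (\sum_(0 <= k <oo) (((h (size (t k)))%:R%:E : \bar R)^-1) <=
      (m.+1%:R^-1)%:E)%E /\
    forall s, (\bigcup_k cylinder (t k)) (zero_extension s).
  by move=> m; apply: small_cover_eventually_zero; rewrite ?invr_gt0.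
pose U m := \bigcup_k cylinder (t m k).
exists (\bigcap_m U m), (\bigcup_m ~` U m); split.
- move=> e /ltr_add_invr[m]; rewrite add0r => me; exists (t m); split.
    by apply: le_lt_trans (ht m).1 _; rewrite lte_fin.
  by move=> x /(_ m I).
- exists (fun m => ~` U m); split=> // m.
  apply: nowhere_dense_setC_eventually_zero => [|s]; last exact: (ht m).2.
  by apply: bigcup_open => k _; exact: open_cylinder.
- by rewrite -setC_bigcap setUv.
Qed.
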